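(* Let $(G,\mathsf X)$ be a contracting group and let $\mathfrak M$ be the associated permutational $G$-bimodule. Suppose that $\mathcal X$ is a locally compact metric space with a co-compact proper right $G$-action by isometries and let $I:\mathcal X\otimes\mathfrak M\to\mathcal X$ be a contracting equivariant map. Then the projective limit of the $G$-spaces and $G$-equivariant maps $$\mathcal X\xleftarrow{I_0}\mathcal X\otimes\mathfrak M\xleftarrow{I_1}\mathcal X\otimes\mathfrak M^{\otimes 2}\xleftarrow{I_2}\mathcal X\otimes\mathfrak M^{\otimes 3}\xleftarrow{I_3}\cdots$$ is homeomorphic as a $G$-space (i.e., by a $G$-equivariant homeomorphism) to the limit $G$-space $\mathcal X_G$. Moreover, for every $x\in\mathfrak M$ the maps $$\xi\otimes v\mapsto\xi\otimes v\otimes x:\ \mathcal X\otimes\mathfrak M^{\otimes n}\to\mathcal X\otimes\mathfrak M^{\otimes(n+1)}$$ agree with the maps $I_n$, and their limit is (under this homeomorphism) the map $\xi\mapsto\xi\otimes x$ on $\mathcal X_G$.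
   Context: **Bimodules and self-similar groups.** A permutational $G$-bimodule is a set $\mathfrak M$ with commuting left and right actions of $G$. It is a ($d$-fold) covering bimodule if the right action is free and has $d<\infty$ orbits; a basis $\mathsf X\subset\mathfrak M$ is a set meeting each right orbit exactly once. A self-similar group $(G,\mathsf X)$ is given by a covering bimodule $\mathfrak M=\mathsf X\cdot G$ with basis $\mathsf X$: for $g\in G$, $x\in\mathsf X$ one writes uniquely $g\cdot x=g(x)\cdot g|_x$ with $g(x)\in\mathsf X$, $g|_x\in G$. The bimodule $\mathfrak M$ is the associated bimodule. The tensor product $\mathfrak M_1\otimes\mathfrak M_2$ is the quotient of $\mathfrak M_1\times\mathfrak M_2$ by $x_1\cdot g\otimes x_2=x_1\otimes g\cdot x_2$. $\mathfrak M^{\otimes n}$ is a covering bimodule with basis the set $\mathsf X^n$ of words $x_1\cdots x_n=x_1\otimes\cdots\otimes x_n$, and for $v\in\mathsf X^n$ one writes $g\cdot v=g(v)\cdot g|_v$; this gives the self-similar action $g(xw)=g(x)\,g|_x(w)$ on finite words $\mathsf X^*$. The group is contracting if there is a finite set $\mathcal N\subset G$ such that for every $g\in G$ there is $n_0$ with $g|_v\in\mathcal N$ for all words $v$ of length $\ge n_0$. **Limit $G$-space.** Let $\mathsf X^{-\omega}$ be the space of left-infinite sequences $\ldots x_2x_1$ over $\mathsf X$ (product topology), $G$ discrete. Two elements $\ldots x_2x_1\cdot g$ and $\ldots y_2y_1\cdot h$ of $\mathsf X^{-\omega}\times G$ are asymptotically equivalent if there are a finite set $N\subset G$ and a sequence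 $g_k\in N$ with $g_k(x_k\ldots x_1)=y_k\ldots y_1$ and $g_k|_{x_k\ldots x_1}g=h$ for all $k$. The limit $G$-space $\mathcal X_G$ is the quotient of $\mathsf X^{-\omega}\times G$ by this equivalence relation, with the right $G$-action induced by right multiplication on the factor $G$. For $x\in\mathfrak M$ and $\xi\in\mathcal X_G$ represented by $\ldots x_2x_1\cdot g$, write $g\cdot x=y\cdot h$ with $y\in\mathsf X$, $h\in G$; then $\xi\otimes x\in\mathcal X_G$ is the point represented by $\ldots x_2x_1y\cdot h$. **Tensor products of spaces.** For a right $G$-space $\mathcal X$, $\mathcal X\otimes\mathfrak M$ is the quotient of $\mathcal X\times\mathfrak M$ ($\mathfrak M$ discrete) by $\xi\cdot g\otimes x=\xi\otimes g\cdot x$, with right action $(\xi\otimes x)\cdot g=\xi\otimes(x\cdot g)$. The action on $\mathcal X$ is proper if for every compact $C\subset\mathcal X$ the set $\{g: C\cdot g\cap C\ne\emptyset\}$ is finite, and co-compact if some compact set meets every orbit. For a continuous $G$-equivariant $I:\mathcal X\otimes\mathfrak M\to\mathcal X$ put $I_n:\mathcal X\otimes\mathfrak M^{\otimes(n+1)}\to\mathcal X\otimes\mathfrak M^{\otimes n}$, $I_n(\xi\otimes x\otimes v)=I(\xi\otimes x)\otimes v$ ($x\in\mathfrak M$, $v\in\mathfrak M^{\otimes n}$; $I_0=I$), and $I^{(n)}(\xi\otimes x_1\otimes\cdots\otimes x_n)=I(\ldots I(I(\xi\otimes x_1)\otimes x_2)\ldots\otimes x_n)$. The map $I$ is contracting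 if there exist $n\ge1$ and $0<\lambda<1$ with $d(I^{(n)}(\xi_1\otimes v),I^{(n)}(\xi_2\otimes v))\le\lambda\,d(\xi_1,\xi_2)$ for all $\xi_1,\xi_2\in\mathcal X$, $v\in\mathfrak M^{\otimes n}$. *)

(* Defs.v *)
From HB Require Import structures.
From mathcomp Require Import all_boot all_order all_algebra.
From mathcomp Require Import all_classical all_reals all_analysis.

Set Implicit Arguments.
Unset Strict Implicit.
Unset Printing Implicit Defensive.

Import Order.TTheory GRing.Theory Num.Theory.
Import numFieldNormedType.Exports.

Local Open Scope classical_set_scope.
Local Open Scope quotient_scope.

Record lact (G : groupType) (T : Type) := LAct {
  lact_fun :> G -> T -> T;
  lact1 : forall x, lact_fun 1%g x = x;
  lactM : forall g h x, lact_fun (g * h)%g x = lact_fun g (lact_fun h x) }.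

Record ract (G : groupType) (T : Type) := RAct {
  ract_fun :> T -> G -> T;
  ract1 : forall x, ract_fun x 1%g = x;
  ractM : forall x g h, ract_fun x (g * h)%g = ract_fun (ract_fun x g) h }.

Record bimodule (G : groupType) := Bimodule {
  bim_sort :> choiceType;
  bim_l : lact G bim_sort;
  bim_r : ract G bim_sort;
  bim_C : forall g x h, bim_r (bim_l g x) h = bim_l g (bim_r x h) }.

Definition right_orbit (G : groupType) (M : bimodule G) (x : M) : set M :=
  range (bim_r M x).

Definition right_free (G : groupType) (M : bimodule G) : Prop :=
  forall (x : M) (g : G), bim_r M x g = x -> g = 1%g.

Definition covering (G : groupType) (M : bimodule G) : Prop :=
  right_free M /\ finite_set (range (@right_orbit G M)).

Definition is_basis (G : groupType) (M : bimodule G) (X : set M) : Prop :=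
  forall m : M, exists! x, X x /\ right_orbit m x.

(** As [G] is a group acting on both factors, the relation identifying
    [(a . g, b)] with [(a, g . b)] for all [a], [b], [g] is already an
    equivalence relation. Below, operations on the quotients are defined on
    chosen representatives; the lemmas with suffix [E] show that they do not
    depend on the choice. *)

Section TensorRel.
Variables (G : groupType) (A B : choiceType) (r : ract G A) (l : lact G B).

Definition tensor_rel : rel (A * B) :=
  fun p q => `[< exists g : G, p.1 = r q.1 g /\ q.2 = l g p.2 >].

Lemma tensor_rel_refl : reflexive tensor_rel.
Proof. by move=> p; apply/asboolP; exists 1%g; rewrite ract1 lact1. Qed.

Lemma tensor_rel_sym : symmetric tensor_rel.
Proof.
suff H p q : tensor_rel p q -> tensor_rel q p.
  by move=> p q; apply/idP/idP; exact: H.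
move=> /asboolP[g [e1 e2]]; apply/asboolP; exists g^-1%g.
by rewrite e1 e2 -ractM -lactM mulgV mulVg ract1 lact1.
Qed.

Lemma tensor_rel_trans : transitive tensor_rel.
Proof.
move=> q p s /asboolP[g [e1 e2]] /asboolP[h [e3 e4]]; apply/asboolP.
by exists (h * g)%g; rewrite ractM lactM -e3 -e2.
Qed.

Canonical tensor_equiv :=
  EquivRel tensor_rel tensor_rel_refl tensor_rel_sym tensor_rel_trans.

End TensorRel.

Section BimoduleTensor.
Variables (G : groupType) (M N : bimodule G).

Definition btens_sort := {eq_quot tensor_equiv (bim_r M) (bim_l N)}.

Definition bmk (x : M) (y : N) : btens_sort := \pi_btens_sort (x, y).

Lemma bmk_eq x y x' y' :
  bmk x y = bmk x' y' <-> exists g, x = bim_r M x' g /\ y' = bim_l N g y.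
Proof. by split => [/eqmodP/asboolP//|H]; apply/eqmodP/asboolP. Qed.

Lemma bmk_surj (z : btens_sort) : bmk (repr z).1 (repr z).2 = z.
Proof. by rewrite /bmk -surjective_pairing reprK. Qed.

Definition btens_l_fun (g : G) (z : btens_sort) : btens_sort :=
  bmk (bim_l M g (repr z).1) (repr z).2.

Definition btens_r_fun (z : btens_sort) (g : G) : btens_sort :=
  bmk (repr z).1 (bim_r N (repr z).2 g).

Lemma btens_lE g x y : btens_l_fun g (bmk x y) = bmk (bim_l M g x) y.
Proof.
have /bmk_eq[h [e1 e2]] := bmk_surj (bmk x y).
by apply/bmk_eq; exists h; rewrite e1 bim_C.
Qed.

Lemma btens_rE x y g : btens_r_fun (bmk x y) g = bmk x (bim_r N y g).
Proof.
have /bmk_eq[h [e1 e2]] := bmk_surj (bmk x y).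
by apply/bmk_eq; exists h; rewrite -bim_C -e2.
Qed.

Lemma btens_ind (P : btens_sort -> Prop) :
  (forall x y, P (bmk x y)) -> forall z, P z.
Proof. by move=> H z; rewrite -(bmk_surj z). Qed.

Lemma btens_l1 z : btens_l_fun 1%g z = z.
Proof. by elim/btens_ind: z => x y; rewrite btens_lE lact1. Qed.

Lemma btens_lM g h z :
  btens_l_fun (g * h)%g z = btens_l_fun g (btens_l_fun h z).
Proof. by elim/btens_ind: z => x y; rewrite !btens_lE lactM. Qed.

Lemma btens_r1 z : btens_r_fun z 1%g = z.
Proof. by elim/btens_ind: z => x y; rewrite btens_rE ract1. Qed.

Lemma btens_rM z g h :
  btens_r_fun z (g * h)%g = btens_r_fun (btens_r_fun z g) h.
Proof. by elim/btens_ind: z => x y; rewrite !btens_rE ractM. Qed.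

Lemma btens_C g z h :
  btens_r_fun (btens_l_fun g z) h = btens_l_fun g (btens_r_fun z h).
Proof. by elim/btens_ind: z => x y; rewrite !(btens_lE, btens_rE). Qed.

Definition btens : bimodule G :=
  @Bimodule G btens_sort (LAct btens_l1 btens_lM) (RAct btens_r1 btens_rM)
    btens_C.

End BimoduleTensor.

(** The index is shifted: [tpowS M n] is the tensor power of [M] with [n.+1]
    factors, so that the first tensor power is [M] itself. *)
Fixpoint tpowS (G : groupType) (M : bimodule G) (n : nat) : bimodule G :=
  if n is m.+1 then btens M (tpowS M m) else M.

Fixpoint tensS (G : groupType) (M : bimodule G) (n : nat) :
    (nat -> M) -> tpowS M n :=
  match n return (nat -> M) -> tpowS M n with
  | 0 => fun x => x 0
  | m.+1 => fun x => bmk (x 0) (tensS m (x \o succn))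
  end.

Lemma tensS_surj (G : groupType) (M : bimodule G) n (v : tpowS M n) :
  exists x : nat -> M, v = tensS n x.
Proof.
elim: n v => [|n IHn] v; first by exists (fun=> v).
elim/btens_ind: v => y v; have [x ->] := IHn v.
by exists (fun i => if i is j.+1 then x j else y).
Qed.

(** [v |-> v (x) a], where the new factor is added at the right end of the
    right-nested tensor power. *)
Fixpoint rtensS (G : groupType) (M : bimodule G) (a : M) (n : nat) :
    tpowS M n -> tpowS M n.+1 :=
  match n return tpowS M n -> tpowS M n.+1 with
  | 0 => fun x => bmk x a
  | m.+1 => fun v : btens_sort M (tpowS M m) =>
      bmk (repr v).1 (rtensS a (repr v).2)
  end.

Lemma rtensS_l (G : groupType) (M : bimodule G) (a : M) n g (v : tpowS M n) :
  rtensS a (bim_l (tpowS M n) g v) = bim_l (tpowS M n.+1) g (rtensS a v).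
Proof.
elim: n g v => [|n IHn] g v; first by rewrite /= btens_lE.
rewrite [RHS]/= btens_lE /=; apply/(bmk_eq (N := tpowS M n.+1)).
have /bmk_eq[h [e1 e2]] : bmk (repr (btens_l_fun g v)).1
    (repr (btens_l_fun g v)).2 = bmk (bim_l M g (repr v).1) (repr v).2.
  by rewrite bmk_surj -btens_lE bmk_surj.
exists h; split; [exact: e1 | rewrite -IHn; congr rtensS; exact: e2].
Qed.

Lemma rtensSE (G : groupType) (M : bimodule G) (a : M) n x (v : tpowS M n) :
  rtensS (n := n.+1) a (bmk x v) = bmk x (rtensS a v).
Proof.
have /bmk_eq[h [e1 e2]] := bmk_surj (bmk x v).
apply/(bmk_eq (N := tpowS M n.+1)); exists h; split; first exact: e1.
by rewrite -rtensS_l; congr rtensS; exact: e2.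
Qed.

Record selfSimilar (G : groupType) := SelfSimilar {
  ss_bim :> bimodule G;
  ss_basis : set ss_bim;
  ss_covering : covering ss_bim;
  ss_basisP : is_basis ss_basis }.

Section SelfSimilar.
Variables (G : groupType) (S : selfSimilar G).

Definition letter : choiceType := set_type (@ss_basis G S).

Lemma letter_coord (m : S) :
  exists xg : letter * G, m = bim_r S (set_val xg.1) xg.2.
Proof.
have [x [[Xx [g _ e]] _]] := ss_basisP m.
exists (exist _ x (mem_set Xx), g^-1)%g.
transitivity (bim_r S x g^-1%g); last by [].
by rewrite -e -ractM mulgV ract1.
Qed.

Lemma letter_coord_uniq (x y : letter) (g h : G) :
  bim_r S (set_val x) g = bim_r S (set_val y) h -> x = y /\ g = h.
Proof.
move=> e; have exy : x = y.
  apply: val_inj; have [z [_ zP]] := ss_basisP (bim_r S (set_val x) g).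
  have zx : z = set_val x.
    apply: zP; split; first exact: set_mem (valP x).
    by exists g^-1%g => //; rewrite -ractM mulgV ract1.
  have zy : z = set_val y.
    apply: zP; split; first exact: set_mem (valP y).
    by exists h^-1%g => //; rewrite e -ractM mulgV ract1.
  exact: etrans (esym zx) zy.
split=> //; have [free _] := ss_covering S.
apply: (mulIg h^-1%g); rewrite mulgV.
by apply: (free (set_val x)); rewrite ractM e -exy -ractM mulgV ract1.
Qed.

(** [m = bhead m . bcoef m] with [bhead m] in the basis and [bcoef m] in [G]. *)
Definition bhead (m : S) : letter := (projT1 (cid (letter_coord m))).1.
Definition bcoef (m : S) : G := (projT1 (cid (letter_coord m))).2.

Lemma bhead_bcoef m : m = bim_r S (set_val (bhead m)) (bcoef m).
Proof. exact: projT2 (cid (letter_coord m)). Qed.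

Lemma bhead_bcoef_uniq m x g :
  m = bim_r S (set_val x) g -> bhead m = x /\ bcoef m = g.
Proof. by move=> e; apply: letter_coord_uniq; rewrite -bhead_bcoef. Qed.

(** [g . x = g(x) . g|_x] with [g(x) = lperm g x], [g|_x = lrestr g x]. *)
Definition lperm (g : G) (x : letter) : letter := bhead (bim_l S g (set_val x)).
Definition lrestr (g : G) (x : letter) : G := bcoef (bim_l S g (set_val x)).

(** [g(v)] and [g|_v] for a word [v]; by [tensS_word] below they satisfy
    [g . v = g(v) . g|_v] in the tensor power of the bimodule. *)
Fixpoint wperm (g : G) (w : seq letter) : seq letter :=
  if w is x :: w' then lperm g x :: wperm (lrestr g x) w' else [::].
Fixpoint wrestr (g : G) (w : seq letter) : G :=
  if w is x :: w' then wrestr (lrestr g x) w' else g.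

Lemma lperm_restr1 x : lperm 1%g x = x /\ lrestr 1%g x = 1%g.
Proof. by apply: bhead_bcoef_uniq; rewrite lact1 ract1. Qed.

Lemma lperm_restrM g h x : lperm (g * h)%g x = lperm g (lperm h x) /\
  lrestr (g * h)%g x = (lrestr g (lperm h x) * lrestr h x)%g.
Proof.
apply: bhead_bcoef_uniq; rewrite lactM [bim_l S h _]bhead_bcoef -bim_C ractM.
by rewrite -/(lperm h x) -/(lrestr h x) -bhead_bcoef.
Qed.

Lemma wperm1 w : wperm 1%g w = w.
Proof. by elim: w => //= x w; have [-> ->] := lperm_restr1 x => ->. Qed.

Lemma wrestr1 w : wrestr 1%g w = 1%g.
Proof. by elim: w => //= x w; have [_ ->] := lperm_restr1 x. Qed.

Lemma wpermM g h w : wperm (g * h)%g w = wperm g (wperm h w).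
Proof.
elim: w g h => //= x w IHw g h.
by have [-> ->] := lperm_restrM g h x; rewrite IHw.
Qed.

Lemma wrestrM g h w :
  wrestr (g * h)%g w = (wrestr g (wperm h w) * wrestr h w)%g.
Proof.
elim: w g h => //= x w IHw g h.
by have [_ ->] := lperm_restrM g h x; rewrite IHw.
Qed.

Lemma size_wperm g w : size (wperm g w) = size w.
Proof. by elim: w g => //= x w IHw g; rewrite IHw. Qed.

Lemma tensS_word n g (x y : nat -> letter) :
  wperm g (mkseq x n.+1) = mkseq y n.+1 ->
  bim_l (tpowS S n) g (tensS n (set_val \o x)) =
  bim_r (tpowS S n) (tensS n (set_val \o y)) (wrestr g (mkseq x n.+1)).
Proof.
elim: n g x y => [|n IHn] g x y.
  by move=> -[exy]; rewrite /= -exy [LHS]bhead_bcoef.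
have mkS z : mkseq z n.+2 = z 0 :: mkseq (z \o succn) n.+1.
  by rewrite /mkseq /= (iotaDl 1 1) -map_comp.
rewrite !mkS => exy.
have e1 : lperm g (x 0) = y 0 := congr1 (head (x 0)) exy.
have /IHn e2 := congr1 behead exy.
rewrite /= btens_lE btens_rE; apply/(bmk_eq (N := tpowS S n)).
exists (lrestr g (x 0)); split; last exact: esym e2.
by rewrite /= -e1 [LHS]bhead_bcoef.
Qed.

Definition contracting_group : Prop :=
  exists N : set G, finite_set N /\
    forall g : G, exists n0 : nat, forall v : seq letter,
      (n0 <= size v)%N -> N (wrestr g v).

End SelfSimilar.

Record gspace (G : groupType) := GSpace {
  gs_sort :> topologicalType;
  gs_act : ract G gs_sort;
  gs_act_continuous : forall g, continuous (fun x => gs_act x g) }.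

Record gmap (G : groupType) (X Y : gspace G) := GMap {
  gmap_fun :> X -> Y;
  gmap_continuous : continuous gmap_fun;
  gmap_equivariant :
    forall x g, gmap_fun (gs_act X x g) = gs_act Y (gmap_fun x) g }.

Definition homeomorphism (X Y : topologicalType) (f : X -> Y) : Prop :=
  continuous f /\
  exists f' : Y -> X, [/\ cancel f f', cancel f' f & continuous f'].

Definition proper_action (G : groupType) (X : gspace G) : Prop :=
  forall C : set X, compact C ->
    finite_set [set g : G | [set gs_act X x g | x in C] `&` C !=set0].

Definition cocompact_action (G : groupType) (X : gspace G) : Prop :=
  exists C : set X, compact C /\
    forall x : X, range (gs_act X x) `&` C !=set0.

Record isomGSpace (R : realType) (G : groupType) := IsomGSpace {
  igs_sort :> metricType R;
  igs_act : ract G igs_sort;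
  igs_isom : forall g x y,
    mdist (igs_act x g) (igs_act y g) = mdist x y }.

Lemma igs_act_continuous (R : realType) (G : groupType) (X : isomGSpace R G)
  g : continuous (fun x : X => igs_act X x g).
Proof.
move=> x; apply/cvg_ballP => e e0; near=> y.
rewrite ballEmdist /= igs_isom.
have : ball x e y by near: y; exact: nbhsx_ballx.
by rewrite ballEmdist.
Unshelve. all: by end_near. Qed.

Coercion gspace_of_isom (R : realType) (G : groupType) (X : isomGSpace R G) :
  gspace G := GSpace (@igs_act_continuous R G X).

Lemma discrete_prod_continuous (X Y : topologicalType) (D : choiceType)
    (f : X * discrete_topology D -> Y) :
  (forall d, continuous (fun x => f (x, d))) -> continuous f.
Proof.
move=> fc [x d] A /(fc d x) xA.
exists ((fun x => f (x, d)) @^-1` A, [set d]) => /=.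
  by split => //; exact: discrete_set1.
by move=> [x' d'] /= [? ->].
Qed.

Section GSpaceTensor.
Variables (G : groupType) (X : gspace G) (M : bimodule G).

Definition gtens_sort := quotient_topology
  {eq_quot @tensor_equiv G X (discrete_topology M) (gs_act X) (bim_l M)}.

Definition gmk (xi : X) (x : M) : gtens_sort := \pi_gtens_sort (xi, x).

Lemma gmk_eq xi x xi' x' : gmk xi x = gmk xi' x' <->
  exists g, xi = gs_act X xi' g /\ x' = bim_l M g x.
Proof. by split => [/eqmodP/asboolP//|H]; apply/eqmodP/asboolP. Qed.

Lemma gmk_surj (z : gtens_sort) : gmk (repr z).1 (repr z).2 = z.
Proof. by rewrite /gmk -surjective_pairing reprK. Qed.

Lemma gtens_ind (P : gtens_sort -> Prop) :
  (forall xi x, P (gmk xi x)) -> forall z, P z.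
Proof. by move=> H z; rewrite -(gmk_surj z). Qed.

Lemma gmk_continuous x : continuous (gmk^~ x).
Proof.
move=> xi A /(@pi_continuous (X * discrete_topology M)%type) /=.
move=> [[B C] /= [xiB /principal_filterP Cx] BCA].
by apply: filterS xiB => eta Beta; apply: (BCA (eta, x)).
Qed.

Lemma gtens_continuous (Y : topologicalType) (f : gtens_sort -> Y) :
  (forall x, continuous (fun xi => f (gmk xi x))) -> continuous f.
Proof.
by move=> fc; apply/quotient_continuous; apply: discrete_prod_continuous.
Qed.

Definition gtens_act_fun (z : gtens_sort) (g : G) : gtens_sort :=
  gmk (repr z).1 (bim_r M (repr z).2 g).

Lemma gtens_actE xi x g : gtens_act_fun (gmk xi x) g = gmk xi (bim_r M x g).
Proof.
have /gmk_eq[h [e1 e2]] := gmk_surj (gmk xi x).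
by apply/gmk_eq; exists h; rewrite -bim_C -e2.
Qed.

Lemma gtens_act1 z : gtens_act_fun z 1%g = z.
Proof. by elim/gtens_ind: z => xi x; rewrite gtens_actE ract1. Qed.

Lemma gtens_actM z g h :
  gtens_act_fun z (g * h)%g = gtens_act_fun (gtens_act_fun z g) h.
Proof. by elim/gtens_ind: z => xi x; rewrite !gtens_actE ractM. Qed.

Lemma gtens_act_continuous g : continuous (gtens_act_fun^~ g).
Proof.
apply: gtens_continuous => x.
rewrite (_ : (fun xi => _) = gmk^~ (bim_r M x g)); first exact: gmk_continuous.
by apply/funext => xi; rewrite gtens_actE.
Qed.

Definition gtens : gspace G :=
  @GSpace G gtens_sort (RAct gtens_act1 gtens_actM) gtens_act_continuous.

End GSpaceTensor.

Lemma prod_topology_continuous (Y : topologicalType) (I : Type)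
    (T : I -> topologicalType) (h : Y -> prod_topology T) :
  (forall i, continuous (fun y => h y i)) -> continuous h.
Proof.
move=> hc y; apply/cvg_sup => i.
exact: (@continuous_comp_initial _ _ _ (fun f : forall i, T i => f i) h (hc i)).
Qed.

Section ProjLim.
Variables (G : groupType) (S : nat -> gspace G).
Variable (f : forall n, gmap (S n.+1) (S n)).

Definition threads : set (prod_topology S) :=
  [set z | forall n, f n (z n.+1) = z n].

Definition projlim_sort : topologicalType := set_type threads.

Definition thread (z : projlim_sort) (n : nat) : S n := set_val z n.

Lemma threadP (z : projlim_sort) n : f n (thread z n.+1) = thread z n.
Proof. exact: (set_mem (valP z)). Qed.

Definition mk_thread (z : forall n, S n) (zP : forall n, f n (z n.+1) = z n) :
  projlim_sort := exist _ (z : prod_topology S) (mem_set zP).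

Lemma thread_inj (z z' : projlim_sort) :
  (forall n, thread z n = thread z' n) -> z = z'.
Proof. by move=> e; apply: val_inj; exact: functional_extensionality_dep. Qed.

Lemma projlim_act_subproof (z : projlim_sort) (g : G) n :
  f n (gs_act (S n.+1) (thread z n.+1) g) = gs_act (S n) (thread z n) g.
Proof. by rewrite gmap_equivariant threadP. Qed.

Definition projlim_act_fun (z : projlim_sort) (g : G) : projlim_sort :=
  mk_thread (projlim_act_subproof z g).

Lemma projlim_act1 z : projlim_act_fun z 1%g = z.
Proof. by apply: thread_inj => n; exact: ract1. Qed.

Lemma projlim_actM z g h :
  projlim_act_fun z (g * h)%g = projlim_act_fun (projlim_act_fun z g) h.
Proof. by apply: thread_inj => n; exact: ractM. Qed.

Lemma projlim_act_continuous g : continuous (projlim_act_fun^~ g).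
Proof.
apply: (@continuous_comp_initial _ _ _ (set_val : threads -> prod_topology S)).
apply: prod_topology_continuous => n z.
apply: (@continuous_comp _ _ _ (thread^~ n) (fun x => gs_act (S n) x g)).
  apply: (@continuous_comp _ _ _ (set_val : threads -> _) (@proj _ S n)).
    exact: initial_continuous.
  exact: proj_continuous.
exact: gs_act_continuous.
Qed.

Definition projlim : gspace G :=
  @GSpace G projlim_sort (RAct projlim_act1 projlim_actM)
    projlim_act_continuous.

(** Maps [t n : S n -> S n.+1] commuting with the bonding maps induce a map
    [(z n)_n |-> (t n (z n))_n.+1] of the projective limit into itself; its
    component of index 0 is determined by the next one. *)
Definition agree (t : forall n, S n -> S n.+1) : Prop :=
  forall n (z : S n.+1), t n (f n z) = f n.+1 (t n.+1 z).

Definition lim_seq (t : forall n, S n -> S n.+1) (z : projlim_sort) (n : nat) :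
    S n :=
  match n return S n with
  | 0 => f 0 (t 0 (thread z 0))
  | m.+1 => t m (thread z m)
  end.

Lemma lim_seqP t (tP : agree t) (z : projlim_sort) n :
  f n (lim_seq t z n.+1) = lim_seq t z n.
Proof. by case: n => [//|n]; rewrite /lim_seq -tP threadP. Qed.

Definition lim_map t (tP : agree t) (z : projlim_sort) : projlim_sort :=
  mk_thread (lim_seqP tP z).

End ProjLim.

Section InverseSystem.
Variables (G : groupType) (X : gspace G) (M : bimodule G).
Variable (I : gmap (gtens X M) X).

Definition stage (n : nat) : gspace G :=
  if n is m.+1 then gtens X (tpowS M m) else X.

Section Ext.
Variable (N : bimodule G).

Definition ext_fun (z : gtens_sort X (btens M N)) : gtens_sort X N :=
  let y : btens_sort M N := (repr z).2 in
  gmk (I (gmk (repr z).1 (repr y).1)) (repr y).2.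

Lemma ext_funE xi x v :
  ext_fun (gmk xi (bmk x v : btens M N)) = gmk (I (gmk xi x)) v.
Proof.
rewrite /ext_fun; set z := gmk xi _; set y : btens_sort M N := (repr z).2.
have /gmk_eq[g [e1 e2]] := gmk_surj z.
have : bmk x v = btens_l_fun g y by [].
rewrite -[y in RHS]bmk_surj btens_lE => /bmk_eq[k [e3 e4]].
apply/gmk_eq; exists k^-1%g; rewrite e4 -lactM mulVg lact1; split => //.
rewrite -gmap_equivariant e3 [gs_act _ _ _]gtens_actE -ractM mulgV ract1.
by congr (I _); apply/gmk_eq; exists g.
Qed.

Lemma ext_continuous : continuous ext_fun.
Proof.
apply: gtens_continuous => w; elim/(@btens_ind _ M N): w => x v.
rewrite (_ : (fun xi => _) = (@gmk _ X N)^~ v \o (I \o (@gmk _ X M)^~ x)).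
  move=> xi; apply: continuous_comp; last exact: gmk_continuous.
  by apply: continuous_comp; [exact: gmk_continuous|exact: gmap_continuous].
by apply/funext => xi; exact: ext_funE.
Qed.

Lemma ext_equivariant z g :
  ext_fun (gtens_act_fun z g) = gtens_act_fun (ext_fun z) g.
Proof.
elim/gtens_ind: z => xi w; elim/(@btens_ind _ M N): w => x v.
by rewrite ext_funE !gtens_actE [bim_r _ _ _]btens_rE ext_funE.
Qed.

Definition ext : gmap (gtens X (btens M N)) (gtens X N) :=
  @GMap G (gtens X (btens M N)) (gtens X N) ext_fun
    ext_continuous ext_equivariant.

End Ext.

(** The maps [I_n]: [step 0 = I], and [step n (xi (x) x (x) v) = I (xi (x) x) (x) v] for
    [n > 0] by [ext_funE]. *)
Definition step (n : nat) : gmap (stage n.+1) (stage n) :=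
  match n return gmap (stage n.+1) (stage n) with
  | 0 => I
  | m.+1 => ext (tpowS M m)
  end.

(** The maps [I^(n)]; see [iter_stepE] for the explicit formula. *)
Fixpoint iter_step (n : nat) : stage n -> X :=
  match n return stage n -> X with
  | 0 => id
  | m.+1 => fun z => iter_step (step m z)
  end.

Lemma iter_stepE n xi (x : nat -> M) :
  iter_step (n := n.+1) (gmk xi (tensS n x)) =
  foldl (fun z y => I (gmk z y)) xi (mkseq x n.+1).
Proof.
elim: n xi x => [//|n IHn] xi x.
rewrite [LHS]/= [ext_fun _]ext_funE [LHS]IHn /mkseq /=.
by rewrite (iotaDl 1 1) -map_comp.
Qed.

(** [xi (x) v |-> xi (x) v (x) a] *)
Definition rtens_stage (a : M) (n : nat) : stage n -> stage n.+1 :=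
  match n return stage n -> stage n.+1 with
  | 0 => fun xi => gmk xi a
  | m.+1 => fun z : gtens_sort X (tpowS M m) =>
      gmk (repr z).1 (rtensS a (repr z).2 : tpowS M m.+1)
  end.

Lemma rtens_stageE a n xi (v : tpowS M n) :
  rtens_stage (n := n.+1) a (gmk xi v) = gmk xi (rtensS a v).
Proof.
have /gmk_eq[g [e1 e2]] := gmk_surj (gmk xi v).
apply/gmk_eq; exists g; split; first exact: e1.
by rewrite -rtensS_l; congr rtensS; exact: e2.
Qed.

End InverseSystem.

(** The number of iterations, at least one, is [n.+1]. *)
Definition contracting_map (R : realType) (G : groupType)
    (X : isomGSpace R G) (M : bimodule G) (I : gmap (gtens X M) X) : Prop :=
  exists (n : nat) (lambda : R), (0 < lambda < 1)%R /\
    forall (xi1 xi2 : X) (v : tpowS M n),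
      (mdist (iter_step I (n := n.+1) (gmk (xi1 : gspace_of_isom X) v) : X)
             (iter_step I (n := n.+1) (gmk (xi2 : gspace_of_isom X) v) : X)
       <= lambda * mdist xi1 xi2)%R.

Section LimitGSpace.
Variables (G : groupType) (S : selfSimilar G).

(** A left-infinite sequence [... x_2 x_1] is represented by
    [w : nat -> letter S] with [w i = x_(i+1)]. *)
Definition lseq : topologicalType :=
  {ptws nat -> discrete_topology (letter S)}.

(** The word [x_k ... x_1]. *)
Definition lword (w : lseq) (k : nat) : seq (letter S) := rev (mkseq w k).

(** The sequence [... x_2 x_1 y]. *)
Definition lrcons (w : lseq) (y : letter S) : lseq :=
  fun i => if i is j.+1 then w j else y.

Definition asymp_rel : rel (lseq * discrete_topology G) :=
  fun p q => `[< exists N : set G, finite_set N /\ exists gk : nat -> G,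
    forall k, (0 < k)%N ->
      [/\ N (gk k),
          wperm (gk k) (lword p.1 k) = lword q.1 k &
          (wrestr (gk k) (lword p.1 k) * (p.2 : G))%g = q.2] >].

Lemma asymp_rel_refl : reflexive asymp_rel.
Proof.
move=> p; apply/asboolP; exists [set 1%g]; split; first exact: finite_set1.
by exists (fun=> 1%g) => k _; rewrite wperm1 wrestr1 mul1g.
Qed.

Lemma asymp_rel_sym : symmetric asymp_rel.
Proof.
suff H p q : asymp_rel p q -> asymp_rel q p.
  by move=> p q; apply/idP/idP; exact: H.
move=> /asboolP[N [finN [gk gkP]]]; apply/asboolP.
exists ((fun g => g^-1%g) @` N); split; first exact: finite_image.
exists (fun k => (gk k)^-1%g) => k /gkP[Nk <- <-]; split; first by exists (gk k).
  by rewrite -wpermM mulVg wperm1.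
by rewrite mulgA -wrestrM mulVg wrestr1 mul1g.
Qed.

Lemma asymp_rel_trans : transitive asymp_rel.
Proof.
move=> q p s /asboolP[N [finN [gk gkP]]] /asboolP[N' [finN' [gk' gkP']]].
apply/asboolP; exists [set (h * g)%g | h in N' & g in N].
split; first exact: finite_image2.
exists (fun k => (gk' k * gk k)%g) => k k0.
have [Nk e1 e2] := gkP k k0; have [Nk' e1' e2'] := gkP' k k0; split.
- by exists (gk' k) => //; exists (gk k).
- by rewrite wpermM e1.
- by rewrite wrestrM e1 -mulgA e2.
Qed.

Canonical asymp_equiv :=
  EquivRel asymp_rel asymp_rel_refl asymp_rel_sym asymp_rel_trans.

Definition limG_sort := quotient_topology {eq_quot asymp_equiv}.

(** The point represented by [... x_2 x_1 . g]. *)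
Definition lpt (w : lseq) (g : G) : limG_sort := \pi_limG_sort (w, g).

Lemma lpt_eq w g u h : lpt w g = lpt u h <-> asymp_rel (w, g) (u, h).
Proof. by split => [/eqmodP|H]; last apply/eqmodP. Qed.

Lemma lpt_surj (z : limG_sort) : lpt (repr z).1 (repr z).2 = z.
Proof. by rewrite /lpt -surjective_pairing reprK. Qed.

Lemma limG_ind (P : limG_sort -> Prop) :
  (forall w g, P (lpt w g)) -> forall z, P z.
Proof. by move=> H z; rewrite -(lpt_surj z). Qed.

Lemma lpt_continuous g : continuous (lpt^~ g).
Proof.
move=> w A /(@pi_continuous (lseq * discrete_topology G)%type) /=.
move=> [[B C] /= [wB /principal_filterP Cg] BCA].
by apply: filterS wB => u Bu; apply: (BCA (u, g)).
Qed.

Lemma limG_continuous (Y : topologicalType) (f : limG_sort -> Y) :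
  (forall g, continuous (fun w => f (lpt w g))) -> continuous f.
Proof.
by move=> fc; apply/quotient_continuous; apply: discrete_prod_continuous.
Qed.

Definition limG_act_fun (z : limG_sort) (h : G) : limG_sort :=
  lpt (repr z).1 ((repr z).2 * h)%g.

Lemma limG_actE w g h : limG_act_fun (lpt w g) h = lpt w (g * h)%g.
Proof.
have /lpt_eq/asboolP[N [finN [gk gkP]]] := lpt_surj (lpt w g).
apply/lpt_eq/asboolP; exists N; split => //; exists gk => k /gkP[Nk e1 e2].
by split => //; rewrite /= mulgA; congr (_ * _)%g; exact: e2.
Qed.

Lemma limG_act1 z : limG_act_fun z 1%g = z.
Proof. by elim/limG_ind: z => w g; rewrite limG_actE mulg1. Qed.

Lemma limG_actM z g h :
  limG_act_fun z (g * h)%g = limG_act_fun (limG_act_fun z g) h.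
Proof. by elim/limG_ind: z => w k; rewrite !limG_actE mulgA. Qed.

Lemma limG_act_continuous h : continuous (limG_act_fun^~ h).
Proof.
apply: limG_continuous => g.
rewrite (_ : (fun w => _) = lpt^~ (g * h)%g); first exact: lpt_continuous.
by apply/funext => w; rewrite limG_actE.
Qed.

Definition limG : gspace G :=
  @GSpace G limG_sort (RAct limG_act1 limG_actM) limG_act_continuous.

(** [xi |-> xi (x) x]: for [xi] represented by [... x_2 x_1 . g], decompose
    [g . x = y . h] and return the point represented by [... x_2 x_1 y . h]. *)
Definition limG_tens (z : limG_sort) (x : S) : limG_sort :=
  let m := bim_l S (repr z).2 x in lpt (lrcons (repr z).1 (bhead m)) (bcoef m).

Lemma lword_lrcons w y k : lword (lrcons w y) k.+1 = rcons (lword w k) y.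
Proof. by rewrite /lword /mkseq /= rev_cons (iotaDl 1 0) -map_comp. Qed.

Lemma wperm_rcons g (v : seq (letter S)) y :
  wperm g (rcons v y) = rcons (wperm g v) (lperm (wrestr g v) y).
Proof. by elim: v g => //= x v IHv g; rewrite IHv. Qed.

Lemma wrestr_rcons g (v : seq (letter S)) y :
  wrestr g (rcons v y) = lrestr (wrestr g v) y.
Proof. by elim: v g => //= x v IHv g; rewrite IHv. Qed.

Lemma limG_tensE w g (x : S) : limG_tens (lpt w g) x =
  lpt (lrcons w (bhead (bim_l S g x))) (bcoef (bim_l S g x)).
Proof.
rewrite /limG_tens; have := lpt_surj (lpt w g).
set u := (repr _).1; set h := (repr _).2; move: u h => u h.
move=> /lpt_eq/asboolP[N [finN [gk gkP]]]; apply/lpt_eq/asboolP.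
set r := (g * h^-1)%g.
have rP k : (0 < k)%N -> wrestr (gk k) (lword u k) = r.
  move=> /gkP[_ _ /= e]; apply: (mulIg h); rewrite mulgVK; exact: e.
have [e1 e2] : lperm r (bhead (bim_l S h x)) = bhead (bim_l S g x) /\
    (lrestr r (bhead (bim_l S h x)) * bcoef (bim_l S h x))%g =
    bcoef (bim_l S g x).
  apply: letter_coord_uniq.
  rewrite ractM -[bim_r S _ (lrestr _ _)]bhead_bcoef bim_C -bhead_bcoef.
  by rewrite -bhead_bcoef -lactM /r mulgVK.
exists (N `|` [set r]); split; first by rewrite finite_setU; split.
exists (fun k => if k is k'.+2 then gk k'.+1 else r) => -[//|[|k]] _.
  by rewrite !lword_lrcons /= e1; split => //; right.
have [Nk e3 _] := gkP k.+1 isT.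
rewrite !(lword_lrcons _ _ k.+1) wperm_rcons wrestr_rcons rP// e3 e1.
by split => //; left.
Qed.

End LimitGSpace.

(* Main.v *)
Require Import Defs.
From HB Require Import structures.
From mathcomp Require Import all_boot all_order all_algebra.
From mathcomp Require Import all_classical all_reals all_analysis.

Set Implicit Arguments.
Unset Strict Implicit.
Unset Printing Implicit Defensive.

Import Order.TTheory GRing.Theory Num.Theory.
Import numFieldNormedType.Exports.

Local Open Scope classical_set_scope.
Local Open Scope ring_scope.

(** Every letter [y] acts on [X] by [xi |-> I (xi (x) y)], and a finite word
    [x_k ... x_1] acts by applying the letters [x_k, ..., x_1] one after the
    other. Long words contract [X] and all orbits of a compact set stay in one
    bounded set, so that the image of a compact set under [x_k ... x_1] shrinks,
    uniformly in the letters, to one point [L (... x_2 x_1)] when [k] grows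
    ([word_limit]). The point exists because [X] is complete: by
    co-compactness, balls of some uniform radius lie in compact sets. The map
    [L] is continuous and [L (... x_2 x_1)] is the image of
    [L (... x_(n+2) x_(n+1))] under [x_n ... x_1]. Hence the points
    [L (... x_(n+1)) (x) x_n ... x_1 . g] form a thread, and sending
    [... x_2 x_1 . g] to this thread is a map [code] from the limit space to
    the projective limit. The theorem takes its inverse.

    The map [code] respects asymptotic equivalence and is injective, because
    two points of [X (x) M^n] given by [xi], [eta] and two words are equal
    exactly when some [k] in [G] moves [eta] to [xi] and transforms one word
    into the other ([stage_pt_eq]): these elements [k] are the ones required by
    the definition of asymptotic equivalence. That they form a finite set is
    properness of the action applied to the compact image of [L]. Conversely,
    elements [k] taken from a finite set disappear in the limit defining [L], up
    to an error that is absorbed since orbits of a proper action are discrete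
    ([orbit_isolated]).

    The map [code] is closed: near a given thread only finitely many [g] can
    occur, again by properness, and for each of them the sequences range over
    the compact space of all sequences, while the projective limit is Hausdorff
    ([code_closed]). The image is dense: represent the [N]-th term of a thread
    as [xi (x) x_N ... x_1 . g] with [xi] in a fixed compact set; its [n]-th
    term is then determined by the image of [xi] under [x_N ... x_(n+1)], which
    is near the value of [L] at any sequence ending in [x_N ... x_(n+1)]
    ([code_surj]). So [code] is a continuous closed bijection. *)

(** * Proper co-compact actions by isometries *)

Lemma nbhs_mdist (R : realType) (X : metricType R) (x : X) (A : set X) :
  nbhs x A <-> exists2 r : R, 0 < r & forall y, mdist x y < r -> A y.
Proof.
rewrite -nbhs_ballE; split=> [[r /= r0 rA]|[r r0 rA]]; exists r => //.
  by move=> y xy; apply: rA; rewrite ballEmdist.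
by move=> y; rewrite ballEmdist; exact: rA.
Qed.

Lemma cvg_mdist (R : realType) (X : metricType R) (u : nat -> X) (l : X) :
  u @ \oo --> l <-> forall e : R, 0 < e ->
    exists k, forall i, (k <= i)%N -> mdist l (u i) < e.
Proof.
split=> [ul e e0|ul A /nbhs_mdist[e /ul[k kP] eA]].
  have /ul[k _ kP] : nbhs l [set y | mdist l y < e].
    by apply/nbhs_mdist; exists e.
  by exists k => i /kP.
by exists k => // i /kP/eA.
Qed.

Section IsometricAction.
Variables (R : realType) (G : groupType) (X : isomGSpace R G).
Local Notation Y := (igs_sort X).
Hypothesis X_locally_compact : locally_compact [set: X].
Hypothesis X_proper : proper_action X.

Lemma compact_nbhs (x : Y) : exists2 K : set Y, compact K & nbhs x K.
Proof.
have [K xK [cK _]] := X_locally_compact (Logic.I : [set: X] x).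
by exists K => //; move: xK; rewrite /within /=; apply: filterS => y; exact.
Qed.

Lemma finite_return (K : set Y) (a : Y) : compact K ->
  finite_set [set g | K (igs_act X a g)].
Proof.
move=> cK; apply: sub_finite_set (X_proper (compactU cK (@compact_set1 _ a))).
move=> g /= Kag; exists (igs_act X a g); split; last by left.
by exists a => //; right.
Qed.

(** A compact neighbourhood of [b] meets the orbit of [a] in finitely many
    points, so a small ball around [b] contains none of them but [b]. *)
Lemma orbit_isolated (a b : Y) : exists2 r : R, 0 < r &
  forall g, mdist b (igs_act X a g) < r -> igs_act X a g = b.
Proof.
have [K cK bK] := compact_nbhs b.
pose A := [set x |
  (exists2 g, K (igs_act X a g) & igs_act X a g = x) /\ x <> b].
have finA : finite_set A.
  apply: sub_finite_set (finite_image (igs_act X a) (finite_return a cK)).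
  by move=> x [[g Kg <-] _]; exists g.
have clA : closed A.
  move: finA; apply: (accessible_finite_set_closed.1 _) => //.
  exact/hausdorff_accessible/metric_hausdorff.
have bA : nbhs b (~` A).
  by apply: open_nbhs_nbhs; split; [exact: closed_openC|case].
have /nbhs_mdist[r r0 rP] : nbhs b (K `&` ~` A) by exact: filterI.
exists r => // g /rP[Kg nA].
by apply: contrapT => gb; apply: nA; split => //; exists g.
Qed.

Hypothesis X_cocompact : cocompact_action X.

(** A radius can be chosen uniformly on a compact set that meets all orbits,
    and isometries carry it to the other points. *)
Lemma uniform_compact_ball : exists2 e : R, 0 < e &
  forall x : Y, exists2 K : set Y, compact K & ball x e `<=` K.
Proof.
have [C [cC CP]] := X_cocompact.
have near_e : \forall e \near (0 : R)^'+, C `<=`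
    (fun x => exists2 K : set Y, compact K & ball x e `<=` K).
  apply: ((compact_near_coveringP C).1 cC R (0 : R)^'+
    (fun e x => exists2 K : set Y, compact K & ball x e `<=` K)) => x Cx.
  have [K cK /nbhs_mdist[r r0 rK]] := compact_nbhs x.
  exists (ball x (r / 2), [set e | e <= r / 2]) => /=.
    split; first by apply: nbhsx_ballx; rewrite divr_gt0.
    by apply: nbhs_right_le; rewrite divr_gt0.
  move=> [y e] /= [+ er]; rewrite ballEmdist /= => xy; exists K => // z.
  rewrite ballEmdist /= => yz; apply: rK.
  rewrite (splitr r); apply: le_lt_trans (metric_triangle _ y _) _.
  by rewrite ltrD// (lt_le_trans yz).
have [e [e0 eP]] : exists e : R, 0 < e /\
    C `<=` (fun x => exists2 K : set Y, compact K & ball x e `<=` K).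
  near (0 : R)^'+ => e; exists e; split=> //.
  by near: e; exact: near_e.
exists e => // x; have [_ [[g _ <-] Cg]] := CP x.
have [K cK eK] := eP _ Cg.
exists ((fun y => igs_act X y g^-1%g) @` K).
  apply: continuous_compact cK; apply: continuous_subspaceT.
  exact: igs_act_continuous.
move=> y xy; exists (igs_act X y g); last by rewrite -ractM mulgV ract1.
by apply: eK; move: xy; rewrite !ballEmdist /= igs_isom.
Unshelve. all: by end_near. Qed.

(** The tail of a Cauchy sequence lies in a ball of the uniform radius above,
    hence in a compact set, where it has a cluster point. *)
Lemma cauchy_seq_converges (u : nat -> Y) :
  (forall e : R, 0 < e -> exists k, forall i j, (k <= i)%N -> (k <= j)%N ->
     mdist (u i) (u j) < e) ->
  exists l : Y, u @ \oo --> l.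
Proof.
move=> cu; have [e e0 eP] := uniform_compact_ball.
have [k kP] := cu e e0; have [K cK kK] := eP (u k).
have [|l [_ ul]] := cK (u @ \oo) _ _.
  by exists k => // i ki; apply: kK; rewrite ballEmdist /=; exact: kP.
exists l; apply/cvg_mdist => r r0.
have r20 : 0 < r / 2 by rewrite divr_gt0.
have [m mP] := cu _ r20.
have [_ [[i mi <-] li]] :
    [set u i | i in [set i | (m <= i)%N]] `&` ball l (r / 2) !=set0.
  by apply: ul; [exists m => // i mi; exists i|exact: nbhsx_ballx].
exists m => j mj; move: li; rewrite ballEmdist /= => li.
rewrite (splitr r); apply: le_lt_trans (metric_triangle _ (u i) _) _.
by apply: ltrD => //; exact: mP.
Qed.

End IsometricAction.

(** * The topology of tensor products and projective limits *)

Lemma gmk_balance (G : groupType) (X : gspace G) (M : bimodule G) (xi : X)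
  (g : G) (v : M) : gmk xi (bim_l M g v) = gmk (gs_act X xi g) v.
Proof.
apply/gmk_eq; exists g^-1%g.
by rewrite -ractM -lactM mulgV mulVg ract1 lact1.
Qed.

Lemma nbhs_gmk (G : groupType) (X : gspace G) (M : bimodule G) (a : X)
    (v : M) (U : set X) : open U -> U a ->
  nbhs (gmk a v) [set z : gtens_sort X M | exists2 xi, U xi & z = gmk xi v].
Proof.
move=> oU Ua; apply: open_nbhs_nbhs; split; last by exists a.
rewrite /open /= /quotient_open openE.
move=> -[eta y] /= [xi Uxi /gmk_eq[g [e1 e2]]].
exists ((fun x => gs_act X x g^-1%g) @^-1` U, [set y]) => /=.
  split; last exact: discrete_set1.
  apply: gs_act_continuous; apply: open_nbhs_nbhs; split=> //.
  by rewrite e1 -ractM mulgV ract1.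
move=> [eta' y'] /= [Ueta ->]; exists (gs_act X eta' g^-1%g) => //.
by apply/gmk_eq; exists g; split => //; rewrite -ractM mulVg ract1.
Qed.

(** Points whose [M]-components lie in different left orbits are separated by
    these orbits. Otherwise both have the form [a (x) v] and [b' (x) v], and
    as [G] acts by isometries, two points of [X] near [a] and [b'] can only be
    identified by an element [g] moving [a] into a small ball around [b'], hence
    to [b'] itself. *)
Lemma gtens_hausdorff (R : realType) (G : groupType) (X : isomGSpace R G)
    (M : bimodule G) :
  locally_compact [set: X] -> proper_action X ->
  hausdorff_space (gtens X M).
Proof.
move=> X_locally_compact X_proper p q.
elim/gtens_ind: p => a v; elim/gtens_ind: q => b u pq.
have [_ [[xi _ ->] [eta _ /gmk_eq[h [_ uE]]]]] :=
  pq _ _ (nbhs_gmk v openT (Logic.I : setT a))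
         (nbhs_gmk u openT (Logic.I : setT b)).
move: pq; rewrite {}uE gmk_balance; set b' := gs_act X b h => pq.
have [r r0 rP] := orbit_isolated X_locally_compact X_proper a b'.
have r20 : 0 < r / 2 by rewrite divr_gt0.
have ballU (c : igs_sort X) : open [set x | mdist c x < r / 2].
  rewrite openE => x /= cx; apply/nbhs_mdist; exists (r / 2 - mdist c x).
    by rewrite subr_gt0.
  move=> y; rewrite ltrBrDl => xy.
  exact: le_lt_trans (metric_triangle _ x _) xy.
have [||_ [[xi' axi ->] [eta' beta /gmk_eq[g [e1 e2]]]]] := pq _ _
  (nbhs_gmk (X := X) v (ballU a) _) (nbhs_gmk (X := X) v (ballU b') _).
- by rewrite /= mdistxx.
- by rewrite /= mdistxx.
apply/esym/gmk_eq; exists g^-1%g.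
split; last by rewrite {2}e2 -lactM mulVg lact1.
rewrite [RHS]rP//; apply: le_lt_trans (metric_triangle _ eta' _) _.
rewrite (splitr r) ltrD// metric_sym.
by rewrite -(@igs_isom _ _ X g) -ractM mulVg ract1 [igs_act _ _ _](esym e1).
Qed.

Section Threads.
Variables (G : groupType) (T : nat -> gspace G).
Variable f : forall n, gmap (T n.+1) (T n).

Lemma thread_continuous n : continuous (fun z : projlim f => thread z n).
Proof.
move=> z.
apply: (@continuous_comp _ _ _ (set_val : threads f -> _) (@proj _ T n)).
  exact: initial_continuous.
exact: proj_continuous.
Qed.

Lemma cvg_thread (u : nat -> projlim f) (z : projlim f) :
  (forall n, (fun i => thread (u i) n) @ \oo --> thread z n) -> u @ \oo --> z.
Proof.
move=> uz.
have vz : (fun i => set_val (u i) : prod_topology T) @ \oo --> set_val z.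
  apply/cvg_sup => n A [_ [[V oV <-] Vz] VA].
  have Vn : nbhs (thread z n) V by apply: open_nbhs_nbhs.
  have [N _ NV] := uz n V Vn; exists N => // i Ni; apply: VA; exact: NV.
move=> A [_ [[V oV <-] Vz] VA].
have /vz[N _ NV] : nbhs (set_val z : prod_topology T) V.
  by apply: open_nbhs_nbhs.
by exists N => // i Ni; apply: VA; exact: NV.
Qed.

Lemma projlim_hausdorff : (forall n, hausdorff_space (T n)) ->
  hausdorff_space (projlim f).
Proof.
move=> hT z z' zz'; apply: thread_inj => n; apply: hT => A B zA z'B.
have [y [Ay By]] := zz' _ _ (thread_continuous zA) (thread_continuous z'B).
by exists (thread y n).
Qed.

End Threads.

(** * Words and tensor powers *)

Section Words.
Variables (G : groupType) (S : selfSimilar G).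
Implicit Types (w u : lseq S) (g h : G) (k n : nat).

Lemma wperm_cat g (s t : seq (letter S)) :
  wperm g (s ++ t) = wperm g s ++ wperm (wrestr g s) t.
Proof. by elim: s g => //= y s IHs g; rewrite IHs. Qed.

Lemma wrestr_cat g (s t : seq (letter S)) :
  wrestr g (s ++ t) = wrestr (wrestr g s) t.
Proof. by elim: s g => //= y s IHs g; rewrite IHs. Qed.

Definition wshift n w : lseq S := fun i => w (n + i)%N.

Lemma wshift_wshift w n k : wshift k (wshift n w) = wshift (n + k)%N w.
Proof. by apply/funext => i; rewrite /wshift addnA. Qed.

Lemma lwordS w n : lword w n.+1 = w n :: lword w n.
Proof. by rewrite /lword mkseqS rev_rcons. Qed.

Lemma size_lword w n : size (lword w n) = n.
Proof. by rewrite /lword size_rev size_mkseq. Qed.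

Lemma lword_wshift w n k :
  lword w (n + k)%N = lword (wshift n w) k ++ lword w n.
Proof.
elim: k => [|k IHk]; first by rewrite addn0.
by rewrite addnS !lwordS IHk.
Qed.

Lemma lword_surj (y : letter S) (s : seq (letter S)) :
  exists w, lword w (size s) = s.
Proof.
exists (fun i => nth y (rev s) i).
by rewrite /lword -[X in mkseq _ X]size_rev mkseq_nth revK.
Qed.

Lemma lword_mkseq w n : mkseq (fun i => w (n - i)%N) n.+1 = lword w n.+1.
Proof.
apply: (@eq_from_nth _ (w 0)); rewrite size_mkseq ?size_lword// => i ilt.
by rewrite nth_mkseq// /lword nth_rev size_mkseq// nth_mkseq// ltn_subrL.
Qed.

Lemma letter_finite : finite_set [set: letter S].
Proof.
have [_ finO] := ss_covering S.
pose f (y : letter S) := @right_orbit G S (set_val y).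
rewrite (_ : [set: letter S] = f @^-1` range (@right_orbit G S)).
  apply: finite_preimage finO => x y _ _ xy.
  have [g _ e] : right_orbit (set_val y) (set_val x : S).
    by rewrite -[right_orbit _]xy; exists 1%g => //; rewrite ract1.
  by apply: (proj1 (@letter_coord_uniq G S x y 1%g g _)); rewrite ract1.
by apply/seteqP; split=> // y _; exists (set_val y).
Qed.

Lemma lseq_compact : compact [set: lseq S].
Proof.
have := @tychonoff nat (fun=> discrete_topology (letter S)) (fun=> setT).
rewrite (_ : [set f : nat -> _ | _] = setT); last by apply/seteqP.
apply=> _.
exact: (@finite_compact (discrete_topology (letter S)) setT letter_finite).
Qed.

Lemma nbhs_lword w k : nbhs w [set u : lseq S | lword u k = lword w k].
Proof.
elim: k => [|k IHk]; first exact: filterS filterT.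
have wk : nbhs w [set u : lseq S | u k = w k].
  have := @proj_continuous nat (fun=> discrete_topology (letter S)) k w.
  by move=> /(_ [set w k]); apply; exact: discrete_set1.
by apply: filterS2 IHk wk => u /= e1 e2; rewrite !lwordS e1 e2.
Qed.

Lemma wshift_continuous n : continuous (wshift n).
Proof.
apply: prod_topology_continuous => i.
exact: (@proj_continuous nat (fun=> discrete_topology (letter S)) (n + i)%N).
Qed.

(** The right action on a tensor power is free because it is free on [M]: the
    element of [G] balancing two representatives of a tensor is trivial as soon
    as their first letters are basis elements. *)
Lemma tensS_inj n (x y : nat -> letter S) g h :
  bim_r (tpowS S n) (tensS n (set_val \o x)) g =
  bim_r (tpowS S n) (tensS n (set_val \o y)) h ->
  mkseq x n.+1 = mkseq y n.+1 /\ g = h.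
Proof.
have mkS z m :
    mkseq z m.+2 = z 0 :: mkseq (z \o succn) m.+1 :> seq (letter S).
  by rewrite /mkseq /= (iotaDl 1 1) -map_comp.
elim: n x y => [|n IHn] x y.
  by rewrite /mkseq /= => /letter_coord_uniq[-> ->].
rewrite !mkS /= !btens_rE => /(@bmk_eq _ _ (tpowS S n))[k [/= e1 e2]].
have [e3 k1] : x 0 = y 0 /\ 1%g = k.
  by apply: letter_coord_uniq; rewrite ract1.
move: e2; rewrite -{}k1 lact1 => /esym /IHn[e4 e5].
by split=> //; rewrite e3 e4.
Qed.

Lemma tensS_coord n (v : tpowS S n) : exists (x : nat -> letter S) g,
  v = bim_r (tpowS S n) (tensS n (set_val \o x)) g.
Proof.
elim: n v => [|n IHn] v.
  by exists (fun=> bhead v), (bcoef v); exact: bhead_bcoef.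
elim/btens_ind: v => m v.
have [x [g e]] := IHn (bim_l (tpowS S n) (bcoef m) v).
exists (fun i => if i is j.+1 then x j else bhead m), g.
rewrite /= btens_rE; apply/bmk_eq; exists (bcoef m); split=> /=.
  exact: bhead_bcoef.
exact: esym e.
Qed.

(** The index is reversed because [tensS] multiplies the entries from left to
    right, while [w] lists the letters of [... x_2 x_1] from right to left. *)
Definition word_tens n w : tpowS S n :=
  tensS n (set_val \o (fun i => w (n - i)%N)).

Lemma word_tens_l n g w u : wperm g (lword w n.+1) = lword u n.+1 ->
  bim_l (tpowS S n) g (word_tens n w) =
  bim_r (tpowS S n) (word_tens n u) (wrestr g (lword w n.+1)).
Proof. by rewrite -!lword_mkseq; exact: tensS_word. Qed.

Lemma word_tens_inj n w u g h :
  bim_r (tpowS S n) (word_tens n w) g = bim_r (tpowS S n) (word_tens n u) h ->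
  lword w n.+1 = lword u n.+1 /\ g = h.
Proof. by move=> /tensS_inj; rewrite !lword_mkseq. Qed.

Lemma word_tens_coord n (v : tpowS S n) : exists w g,
  v = bim_r (tpowS S n) (word_tens n w) g.
Proof.
have [x [g ->]] := tensS_coord v.
exists (fun i => x (n - i)%N), g; congr (bim_r _ _ g).
have := @tensS_word _ S n 1%g x (fun i => x (n - (n - i))%N).
rewrite lact1 wrestr1 ract1 wperm1; apply; apply/eq_in_map => i.
by rewrite mem_iota ltnS => /andP[_ /subKn ->].
Qed.

Lemma rtensS_tensS n (a : S) (x : nat -> S) :
  rtensS a (tensS n x) = tensS n.+1 (fun i => if (i <= n)%N then x i else a).
Proof.
elim: n x => [//|n IHn] x.
by rewrite [LHS](@rtensSE G S a n (x 0) (tensS n (x \o succn))) IHn.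
Qed.

Lemma rtensS_r n (a : S) (v : tpowS S n) g :
  rtensS a (bim_r (tpowS S n) v g) = rtensS (bim_l S g a) v.
Proof.
elim: n v => [|n IHn] v; first by apply/bmk_eq; exists g.
elim/btens_ind: v => m v; rewrite /= btens_rE.
by rewrite [LHS](@rtensSE G S) IHn -[LHS](@rtensSE G S).
Qed.

Lemma rtensS_actr n (a : S) (v : tpowS S n) g :
  rtensS (bim_r S a g) v = bim_r (tpowS S n.+1) (rtensS a v) g.
Proof.
elim: n v => [|n IHn] v; first by rewrite /= btens_rE.
elim/btens_ind: v => m v.
rewrite [LHS](@rtensSE G S) IHn.
have -> : rtensS a (bmk m v : tpowS S n.+1) = bmk m (rtensS a v).
  exact: rtensSE.
by rewrite [RHS]btens_rE.
Qed.

Lemma rtensS_word_tens n w (y : letter S) :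
  rtensS (set_val y) (word_tens n w) = word_tens n.+1 (lrcons w y).
Proof.
rewrite rtensS_tensS; congr tensS; apply/funext => i.
have [ile|nle] := leqP i n; first by rewrite /= subSn.
by rewrite /= (eqP (nle : (n.+1 - i)%N == 0%N)).
Qed.

End Words.

(** * Coordinates on the inverse system *)

Section StagePoints.
Variables (G : groupType) (S : selfSimilar G) (X : gspace G).
Variable I : gmap (gtens X S) X.
Implicit Types (w u : lseq S) (g h k : G) (xi eta : X).

(** The point [xi (x) x_n ... x_1 . g], where [w] is [... x_2 x_1]. *)
Definition stage_pt (n : nat) (xi : X) (w : lseq S) (g : G) : stage X S n :=
  match n return stage X S n with
  | 0 => gs_act X xi g
  | m.+1 => gmk xi (bim_r (tpowS S m) (word_tens m w) g)
  end.

(** An element [k] balancing the two representatives moves [x_n ... x_1 . g]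
    to [k(x_n ... x_1) . (k|_(x_n ... x_1) g)], and words with coefficients in
    [G] are unique. *)
Lemma stage_pt_eq n xi eta w u g h :
  stage_pt n xi w g = stage_pt n eta u h <->
  exists k, [/\ xi = gs_act X eta k, wperm k (lword w n) = lword u n &
                (wrestr k (lword w n) * g)%g = h].
Proof.
case: n => [|n] /=.
  split=> [e|[k [-> _ <-]]]; last by rewrite ractM.
  exists (h * g^-1)%g; rewrite mulgVK; split=> //.
  by rewrite ractM -e -ractM mulgV ract1.
split=> [/gmk_eq[k [-> e]]|[k [-> e1 <-]]].
  have [u'] := lword_surj (w 0) (wperm k (lword w n.+1)).
  rewrite size_wperm size_lword => u'P.
  have /word_tens_inj[e1 e2] :
      bim_r (tpowS S n) (word_tens n u') (wrestr k (lword w n.+1) * g)%g =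
      bim_r (tpowS S n) (word_tens n u) h.
    by rewrite e -bim_C (word_tens_l (esym u'P)) -ractM.
  by exists k; rewrite -u'P.
apply/gmk_eq; exists k; split=> //.
by rewrite -bim_C (word_tens_l e1) -ractM.
Qed.

Lemma stage_pt_lword n xi w u g :
  lword w n = lword u n -> stage_pt n xi w g = stage_pt n xi u g.
Proof.
move=> e; apply/stage_pt_eq; exists 1%g.
by rewrite ract1 wperm1 wrestr1 mul1g.
Qed.

Lemma stage_pt_translate n xi w g k : exists u h,
  stage_pt n xi w g = stage_pt n (gs_act X xi k) u h.
Proof.
have [u] := lword_surj (w 0) (wperm k^-1%g (lword w n)).
rewrite size_wperm size_lword => uP.
exists u, (wrestr k^-1%g (lword w n) * g)%g; apply/stage_pt_eq; exists k^-1%g.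
by rewrite -ractM mulgV ract1.
Qed.

Lemma stage_pt_surj n (y : letter S) (z : stage X S n) :
  exists xi w g, z = stage_pt n xi w g.
Proof.
case: n z => [|n] z; first by exists z, (fun=> y), 1%g; rewrite /= ract1.
elim/gtens_ind: z => xi v; have [w [g ->]] := word_tens_coord v.
by exists xi, w, g.
Qed.

Lemma stage_pt_continuous n w g : continuous (fun xi => stage_pt n xi w g).
Proof.
by case: n => [|n]; [exact: gs_act_continuous|exact: gmk_continuous].
Qed.

Lemma stage_pt_act n xi w g h :
  gs_act (stage X S n) (stage_pt n xi w g) h = stage_pt n xi w (g * h)%g.
Proof.
by case: n => [|n] /=; rewrite ?ractM// [LHS]gtens_actE -ractM.
Qed.

Lemma step_stage_pt n xi w g :
  step I n (stage_pt n.+1 xi w g) =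
  stage_pt n (I (gmk xi (set_val (w n)))) w g.
Proof.
case: n => [|n].
  by rewrite /= -gmap_equivariant [gs_act _ _ _]gtens_actE.
by rewrite /= /word_tens /= btens_rE [LHS]ext_funE subn0.
Qed.

Lemma rtens_stage_pt n xi w g (a : S) :
  rtens_stage a (stage_pt n xi w g) =
  stage_pt n.+1 xi (lrcons w (bhead (bim_l S g a))) (bcoef (bim_l S g a)).
Proof.
case: n => [|n]; rewrite /stage_pt.
  by rewrite /word_tens /= -bhead_bcoef; apply/gmk_eq; exists g.
rewrite [LHS]rtens_stageE; congr gmk.
by rewrite rtensS_r {1}[bim_l S g a]bhead_bcoef rtensS_actr rtensS_word_tens.
Qed.

Lemma rtens_stage_agree (a : S) : agree (step I) (rtens_stage a).
Proof.
case=> [|n] z; elim/gtens_ind: z => xi v.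
  have -> : rtens_stage (n := 1) a (gmk xi v) = gmk xi (bmk v a : tpowS S 1).
    exact: (@rtens_stageE G X S a 0 xi v).
  by rewrite [RHS]ext_funE.
elim/btens_ind: v => m v.
have -> : step I n.+1 (gmk xi (bmk m v : tpowS S n.+1)) = gmk (I (gmk xi m)) v.
  exact: ext_funE.
have -> : rtens_stage (n := n.+2) a (gmk xi (bmk m v : tpowS S n.+1)) =
    gmk xi (bmk m (rtensS a v) : tpowS S n.+2).
  by rewrite [LHS]rtens_stageE; congr gmk; exact: rtensSE.
by rewrite [LHS]rtens_stageE [RHS]ext_funE.
Qed.

Definition wact (xi : X) (s : seq (letter S)) : X :=
  foldl (fun z y => I (gmk z (set_val y))) xi s.

Lemma wact_cat xi s t : wact xi (s ++ t) = wact (wact xi s) t.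
Proof. exact: foldl_cat. Qed.

Lemma wact_continuous s : continuous (wact^~ s).
Proof.
elim: s => [|y s IHs] xi; first exact: cvg_id.
apply: (@continuous_comp _ _ _ (fun z => I (gmk z (set_val y))) (wact^~ s)).
  apply: continuous_comp; first exact: gmk_continuous.
  exact: gmap_continuous.
exact: IHs.
Qed.

Lemma wact_act xi g s :
  wact (gs_act X xi g) s = gs_act X (wact xi (wperm g s)) (wrestr g s).
Proof.
elim: s xi g => [//|y s IHs] xi g /=.
rewrite -IHs -gmap_equivariant; congr (wact (I _) s).
by rewrite [RHS]gtens_actE -bhead_bcoef gmk_balance.
Qed.

Lemma thread_stage_pt (z : projlim (step I)) n j xi w g :
  thread z (n + j)%N = stage_pt (n + j) xi w g ->
  thread z n = stage_pt n (wact xi (lword (wshift n w) j)) w g.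
Proof.
elim: j xi => [|j IHj] xi; first by rewrite addn0.
rewrite addnS => e; rewrite lwordS; apply: IHj.
by rewrite -threadP e step_stage_pt.
Qed.

End StagePoints.

(** * Limits of contracting words *)

Lemma compact_loc_bounded (R : realType) (T : topologicalType) (K : set T)
    (f : T -> R) : compact K ->
  (forall x, K x -> exists D, \forall y \near x, f y <= D) ->
  exists D, forall x, K x -> f x <= D.
Proof.
move=> cK fb.
have [D0 [_ DP]] : \forall D \near +oo, K `<=` (fun x => f x <= D).
  apply: ((compact_near_coveringP K).1 cK R +oo (fun D x => f x <= D)) => x.
  move=> /fb[D xD]; exists ([set y | f y <= D], [set e | D <= e]) => /=.
    by split=> //; apply: nbhs_pinfty_ge; exact: num_real.
  by move=> [y e] /= [/le_trans]; exact.
by exists (D0 + 1) => x; apply: DP; rewrite ltrDl.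
Qed.

Lemma contracting_map_wact (R : realType) (G : groupType) (S : selfSimilar G)
    (X : isomGSpace R G) (I : gmap (gtens X S) X) : contracting_map I ->
  exists m (lambda : R), 0 < lambda < 1 /\ forall (xi eta : igs_sort X) s,
    size s = m.+1 -> mdist (wact I xi s : igs_sort X) (wact I eta s) <=
      lambda * mdist xi eta.
Proof.
move=> [m [lambda [l01 H]]]; exists m, lambda; split=> // xi eta s sm.
have [w ws] : exists w : lseq S, mkseq w m.+1 = s.
  case: s sm => // y s sm; exists (nth y (y :: s)).
  by rewrite -sm mkseq_nth.
have wactE z : wact I z s =
    iter_step I (n := m.+1) (gmk z (tensS m (set_val \o w))).
  rewrite iter_stepE -ws /wact /mkseq map_comp.
  by elim: (map w _) z => //= y t IHt z; exact: IHt.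
by rewrite !wactE; exact: H.
Qed.

(** The convergence is required uniformly in the sequence and, on compact sets,
    in the starting point: uniformity in the sequence makes [L] continuous, and
    compact sets of starting points occur as translates [xi . g] with [g] in a
    finite set and as representatives of the points of a thread. *)
Definition uniform_word_limit (R : realType) (G : groupType)
    (S : selfSimilar G) (X : isomGSpace R G) (I : gmap (gtens X S) X)
    (L : lseq S -> igs_sort X) : Prop :=
  forall (K : set (igs_sort X)) (e : R), compact K -> 0 < e ->
    exists k0, forall w (xi : igs_sort X) k, K xi -> (k0 <= k)%N ->
      mdist (L w) (wact I xi (lword w k)) < e.

Section Contraction.
Variables (R : realType) (G : groupType) (S : selfSimilar G).
Variable X : isomGSpace R G.
Hypothesis X_locally_compact : locally_compact [set: X].
Hypothesis X_cocompact : cocompact_action X.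
Variable I : gmap (gtens X S) X.
Local Notation Y := (igs_sort X).
Local Notation act := (wact I : Y -> seq (letter S) -> Y).

(** There are finitely many words of bounded length, and each acts by a
    continuous map. *)
Lemma wact_compact_bounded (p : Y) (k : nat) (K : set Y) : compact K ->
  exists D : R, forall xi s, K xi -> (size s <= k)%N ->
    mdist p (act xi s) <= D.
Proof.
elim: k K => [|k IHk] K cK; last first.
  have /choice[D DP] (y : letter S) : exists D : R,
      forall xi s, K xi -> (size s <= k)%N -> mdist p (act xi (y :: s)) <= D.
    have [|D DP] := IHk (act^~ [:: y] @` K).
      apply: continuous_compact cK; apply: continuous_subspaceT.
      exact: (@wact_continuous G S X I [:: y]).
    by exists D => xi s Kxi; apply: (DP (act xi [:: y])); exists xi.
  have [D0 D0P] := IHk K cK.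
  have [D1 D1P] : exists D1 : R, forall y, [set: letter S] y -> D y <= D1.
    have /finite_seqP[ys ysP] := letter_finite S.
    exists (\big[Num.max/D0]_(y <- ys) D y) => y; rewrite ysP /= => yin.
    exact: le_bigmax_seq.
  exists (Num.max D0 D1) => xi [|y s] Kxi sk; rewrite le_max.
    by rewrite D0P.
  by apply/orP; right; apply: le_trans (DP y xi s Kxi sk) _; exact: D1P.
have [x Kx|D DP] :=
    @compact_loc_bounded _ _ K (fun x : Y => mdist p x) cK _.
  exists (mdist p x + 1); apply/nbhs_mdist; exists 1 => // y xy.
  by rewrite (le_trans (metric_triangle _ x _))// lerD2l ltW.
by exists D => xi [|//] Kxi _; exact: DP.
Qed.

Variables (m : nat) (lambda : R).
Hypothesis lambda01 : 0 < lambda < 1.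
Hypothesis act_contract : forall xi eta s, size s = m.+1 ->
  mdist (act xi s) (act eta s) <= lambda * mdist xi eta.

Let lambda0 : 0 < lambda. Proof. by case/andP: lambda01. Qed.
Let lambda1 : lambda < 1. Proof. by case/andP: lambda01. Qed.

Definition orbit_within (p : Y) (D : R) : set Y :=
  [set xi | forall s, mdist p (act xi s) <= D].

Lemma orbit_within_act p D xi s :
  orbit_within p D xi -> orbit_within p D (act xi s).
Proof. by move=> xiD t; have := xiD (s ++ t); rewrite wact_cat. Qed.

Let split_last (s : seq (letter S)) : (m < size s)%N -> exists s1 s2,
  [/\ s = s1 ++ s2, size s2 = m.+1 & size s = (size s1 + m.+1)%N].
Proof.
move=> ms; exists (take (size s - m.+1) s), (drop (size s - m.+1) s).
by rewrite cat_take_drop size_drop size_takel ?leq_subr// subKn// subnK.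
Qed.

(** If [D1] bounds the distances from [p] reached by words of length at most
    [m.+1], then splitting the last [m.+1] letters off a longer word shows that
    a bound [D] for shorter words propagates as long as
    [D1 + lambda * D <= D], which [D1 / (1 - lambda)] satisfies. *)
Lemma orbit_bounded (p : Y) (K : set Y) : compact K ->
  exists D : R, (K `|` [set p]) `<=` orbit_within p D.
Proof.
move=> cK.
have [D1 D1P] := wact_compact_bounded p m.+1 (compactU cK (@compact_set1 _ p)).
have D10 : 0 <= D1.
  by apply: le_trans (D1P p [::] _ _); [exact: mdist_ge0|right|].
have l10 : 0 < 1 - lambda by rewrite subr_gt0.
exists (D1 / (1 - lambda)) => xi Kxi s.
have [n] := ubnP (size s); elim: n s => [//|n IHn] s sn.
have [sm|/split_last[s1 [s2 [e1 s2m e]]]] := leqP (size s) m.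
  rewrite (le_trans (D1P xi s Kxi (leqW sm)))//.
  by rewrite ler_pdivlMr// ler_piMr// gerBl ltW.
rewrite e1 wact_cat (le_trans (metric_triangle _ (act p s2) _))//.
have := D1P p s2 (or_intror erefl); rewrite s2m leqnn => /(_ isT) pD1.
apply: (le_trans (lerD pD1 (act_contract _ _ s2m))).
have /IHn ps1 : (size s1 < n)%N.
  by rewrite -ltnS (leq_trans _ sn)// ltnS e addnS ltnS leq_addr.
rewrite -lerBrDl (le_trans (ler_wpM2l (ltW lambda0) ps1))//.
rewrite lerBrDl -lerBrDr -[X in _ <= X - _]mul1r -mulrBl mulrC divfK//.
by rewrite gt_eqF.
Qed.

Lemma orbits_contract (p : Y) (D e : R) : 0 < e ->
  exists k, forall xi eta s, orbit_within p D xi -> orbit_within p D eta ->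
    (k <= size s)%N -> mdist (act xi s) (act eta s) < e.
Proof.
move=> e0.
have main j xi eta s : orbit_within p D xi -> orbit_within p D eta ->
    (j * m.+1 <= size s)%N ->
    mdist (act xi s) (act eta s) <= geometric (D + D) lambda j.
  move=> xiD etaD; elim: j s => [|j IHj] s /=.
    rewrite expr0 mulr1 => _; apply: le_trans (metric_triangle _ p _) _.
    by rewrite lerD// metric_sym.
  move=> js; have /split_last[s1 [s2 [e1 s2m e2]]] : (m < size s)%N.
    by apply: leq_trans js; rewrite mulSn leq_addr.
  rewrite e1 !wact_cat (le_trans (act_contract _ _ s2m))//.
  rewrite exprS mulrCA ler_pM2l//; apply: IHj.
  by move: js; rewrite e2 mulSn addnC leq_add2r.
have /cvg_geometric : `|lambda| < 1 by rewrite gtr0_norm.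
move=> /(_ (D + D))/(@cvgr_dist_lt _ _ _ _ _ _ 0)/(_ e e0)[j _ jP].
exists (j * m.+1)%N => xi eta s xiD etaD js.
apply: le_lt_trans (main _ _ _ _ xiD etaD js) _.
have := jP j (leqnn j).
by rewrite /= sub0r normrN; apply: le_lt_trans; exact: ler_norm.
Qed.

(** For [k >= k0] the point [act xi (x_k ... x_1)] is the image under
    [x_k0 ... x_1] of a point whose orbit is bounded by the same constant, so
    two such points are close to each other by [orbits_contract]. *)
Lemma word_limit : [set: X] !=set0 ->
  exists L : lseq S -> Y, uniform_word_limit I L.
Proof.
move=> [p _].
have [D0 D0P] := orbit_bounded p (@compact_set1 _ p).
have pD0 : orbit_within p D0 p by apply: D0P; right.
have lwordD w k0 k : (k0 <= k)%N -> exists s, forall xi,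
    act xi (lword w k) = act (act xi s) (lword w k0).
  move=> /subnKC <-; exists (lword (wshift k0 w) (k - k0)) => xi.
  by rewrite -wact_cat -lword_wshift.
have /choice[L LP] (w : lseq S) : exists l : Y,
    (fun k => act p (lword w k)) @ \oo --> l.
  apply: cauchy_seq_converges => // e /(orbits_contract p D0)[k0 k0P].
  exists k0 => i j /(lwordD w)[s ->] /(lwordD w)[t ->].
  by apply: k0P; rewrite ?size_lword//; exact: orbit_within_act.
exists L => K e cK e0; have [D DP] := orbit_bounded p cK.
have e20 : 0 < e / 2 by rewrite divr_gt0.
have [k0 k0P] := orbits_contract p D e20.
exists k0 => w xi k Kxi k0k.
have /cvg_mdist/(_ _ e20)[k1 k1P] := LP w.
have [s sP] := lwordD w k (maxn k k1) (leq_maxl _ _).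
apply: le_lt_trans
  (metric_triangle _ (act p (lword w (maxn k k1))) _) _.
rewrite (splitr e) ltrD ?k1P ?leq_maxr// sP.
apply: k0P; last by rewrite size_lword.
  by apply: orbit_within_act; apply: DP; right.
by apply: DP; left.
Qed.

End Contraction.

Section WordLimit.
Variables (R : realType) (G : groupType) (S : selfSimilar G).
Variable X : isomGSpace R G.
Variable I : gmap (gtens X S) X.
Local Notation Y := (igs_sort X).
Local Notation act := (wact I : Y -> seq (letter S) -> Y).
Variable L : lseq S -> Y.
Hypothesis LP : uniform_word_limit I L.

Lemma word_limit_continuous : continuous L.
Proof.
move=> w A /nbhs_mdist[e e0 eA].
have e20 : 0 < e / 2 by rewrite divr_gt0.
have [k0 k0P] := LP (@compact_set1 _ (L w)) e20.
apply: filterS (nbhs_lword w k0) => u /= uw; apply: eA.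
apply: le_lt_trans (metric_triangle _ (act (L w) (lword w k0)) _) _.
by rewrite (splitr e) ltrD ?k0P// metric_sym -uw k0P.
Qed.

Lemma word_limit_range_compact : compact (range L).
Proof.
apply: continuous_compact (@lseq_compact G S).
by apply: continuous_subspaceT; exact: word_limit_continuous.
Qed.

Lemma word_limit_cvg w (xi : Y) :
  (fun k => act xi (lword w k)) @ \oo --> L w.
Proof.
apply/cvg_mdist => e /(LP (@compact_set1 _ xi))[k0 k0P].
by exists k0 => i; exact: k0P.
Qed.

Lemma word_limit_shift w n : L w = act (L (wshift n w)) (lword w n).
Proof.
have cvg1 : (fun k => act (L w) (lword w (n + k)%N)) @ \oo --> L w.
  have /cvg_mdist H := @word_limit_cvg w (L w).
  apply/cvg_mdist => e /H[k0 k0P]; exists k0 => i i0; apply: k0P.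
  exact: leq_trans i0 (leq_addl _ _).
apply: (cvg_unique (@metric_hausdorff _ Y) cvg1).
have -> : (fun k => act (L w) (lword w (n + k)%N)) =
    act^~ (lword w n) \o (fun k => act (L w) (lword (wshift n w) k)).
  by apply/funext => k; rewrite lword_wshift wact_cat.
apply: cvg_comp; first exact: word_limit_cvg.
exact: (@wact_continuous G S X I (lword w n) (L (wshift n w))).
Qed.

End WordLimit.

(** * The map from the limit space to the projective limit *)

Section Coding.
Variables (R : realType) (G : groupType) (S : selfSimilar G).
Variable X : isomGSpace R G.
Variable I : gmap (gtens X S) X.
Hypothesis X_locally_compact : locally_compact [set: X].
Hypothesis X_cocompact : cocompact_action X.
Hypothesis X_proper : proper_action X.
Local Notation Y := (igs_sort X).
Local Notation act := (wact I : Y -> seq (letter S) -> Y).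
Variable L : lseq S -> Y.
Hypothesis LP : uniform_word_limit I L.
Local Notation lpt := (@lpt G S).
Local Notation stage_pt := (@stage_pt G S X).

Definition code_pt n (w : lseq S) (g : G) : stage X S n :=
  stage_pt n (L (wshift n w)) w g.

Lemma code_ptP w g n : step I n (code_pt n.+1 w g) = code_pt n w g.
Proof.
rewrite /code_pt step_stage_pt; congr stage_pt.
rewrite [RHS](word_limit_shift LP _ 1) wshift_wshift addn1.
by rewrite /wact /= /wshift addn0.
Qed.

Definition code_thread w g : projlim (step I) := mk_thread (code_ptP w g).

(** For the direct implication, let [gk] be the elements of a finite set that
    witness the asymptotic equivalence. To compare the points of level [n], take
    for [k] the restriction of [gk (n + j)] to the [j] letters that precede the
    last [n] ones. It maps [L (wshift n u)] close to [L (wshift n w)] for large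
    [j], since acting by the long word on [L w . gk (n + j)] or on [L w] gives
    nearly the same point, and hence exactly to it by [orbit_isolated]. *)
Lemma code_thread_eq w u g h :
  lpt w g = lpt u h <-> code_thread w g = code_thread u h.
Proof.
split=> [/lpt_eq/asboolP[N [finN [gk gkP]]]|e].
  apply: thread_inj => n.
  apply: (@stage_pt_eq G S X n (L (wshift n w)) (L (wshift n u)) w u g h).2.
  have [r r0 rP] := orbit_isolated X_locally_compact X_proper
    (L (wshift n u)) (L (wshift n w)).
  have r20 : 0 < r / 2 by rewrite divr_gt0.
  pose xi := L w.
  have [k1 k1P] := LP (finite_compact (finite_image (igs_act X xi) finN)) r20.
  have [k2 k2P] := LP (@compact_set1 _ xi) r20.
  pose j := (maxn k1 k2).+1.
  have [Ng] := gkP (n + j)%N (ltn_addl n (ltn0Sn _)).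
  set g0 := gk _ in Ng *; rewrite /= !lword_wshift wperm_cat wrestr_cat.
  set k := wrestr g0 _ => /eqP; rewrite eqseq_cat ?size_wperm ?size_lword//.
  move=> /andP[/eqP e1 /eqP e2] e3; exists k; split=> //.
  apply/esym/rP; apply: le_lt_trans
    (metric_triangle _ (act (igs_act X xi g0) (lword (wshift n w) j)) _) _.
  rewrite (splitr r) ltrD//.
    by apply: k1P; [exists g0|rewrite ltnW// ltnS leq_maxl].
  rewrite [wact _ _ _]wact_act e1 -/k igs_isom metric_sym.
  by apply: k2P => //; rewrite ltnW// ltnS leq_maxr.
have /choice[k kP] n : exists k,
    [/\ L (wshift n w) = igs_act X (L (wshift n u)) k,
        wperm k (lword w n) = lword u n & (wrestr k (lword w n) * g)%g = h].
  apply: (@stage_pt_eq G S X n (L (wshift n w)) (L (wshift n u)) w u g h).1.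
  by have := congr1 (fun z => thread z n) e.
apply/lpt_eq/asboolP.
exists [set g | [set gs_act X x g | x in range L] `&` range L !=set0].
split; first exact: X_proper (word_limit_range_compact LP).
exists k => n _; have [e1 e2 e3] := kP n; split=> //.
exists (L (wshift n w)); split; last by exists (wshift n w).
by exists (L (wshift n u)); [exists (wshift n u)|rewrite e1].
Qed.

Definition code (z : limG S) : projlim (step I) :=
  code_thread (repr z).1 (repr z).2.

Lemma codeE w g : code (lpt w g) = code_thread w g.
Proof. by apply/code_thread_eq; exact: lpt_surj. Qed.

Lemma code_inj : injective code.
Proof. by move=> z z' /code_thread_eq; rewrite !lpt_surj. Qed.

Lemma code_equivariant z h :
  code (gs_act (limG S) z h) = gs_act (projlim (step I)) (code z) h.
Proof.
elim/limG_ind: z => w g; rewrite [gs_act _ _ _]limG_actE !codeE.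
by apply: thread_inj => n; rewrite [RHS]stage_pt_act.
Qed.

Lemma code_tens z (x : S) :
  code (limG_tens z x) = lim_map (rtens_stage_agree I x) (code z).
Proof.
elim/limG_ind: z => w g; rewrite limG_tensE !codeE.
have threadS n : thread (code_thread (lrcons w (bhead (bim_l S g x)))
      (bcoef (bim_l S g x))) n.+1 =
    thread (lim_map (rtens_stage_agree I x) (code_thread w g)) n.+1.
  by rewrite [RHS]rtens_stage_pt.
apply: thread_inj => -[|n]; last exact: threadS.
by rewrite -[LHS]threadP -[RHS]threadP threadS.
Qed.

(** Near [w] the last [n] letters are constant, and only [L (wshift n w)]
    varies. *)
Lemma code_pt_continuous n g : continuous (fun w => code_pt n w g).
Proof.
move=> w A wA.
have : {for w, continuous (fun u => stage_pt n (L (wshift n u)) w g)}.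
  apply: (@continuous_comp _ _ _ (fun u => L (wshift n u))
    (fun xi => stage_pt n (xi : X) w g)); last exact: stage_pt_continuous.
  apply: continuous_comp; first exact: wshift_continuous.
  exact: word_limit_continuous LP _.
move=> /(_ _ wA); apply: filterS2 (nbhs_lword w n) => u /= e.
by rewrite (stage_pt_lword _ _ (esym e)).
Qed.

Lemma code_thread_continuous g : continuous (code_thread^~ g).
Proof.
apply: (@continuous_comp_initial _ _ _
  (set_val : threads (step I) -> prod_topology _)).
by apply: prod_topology_continuous => n; exact: code_pt_continuous.
Qed.

Lemma code_continuous : continuous code.
Proof.
apply: limG_continuous => g.
rewrite (_ : (fun w => _) = code_thread^~ g).
  exact: code_thread_continuous.
by apply/funext => w; rewrite codeE.
Qed.

Lemma stage_hausdorff n : hausdorff_space (stage X S n).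
Proof.
case: n => [|n]; first exact: (@metric_hausdorff _ Y).
exact: gtens_hausdorff.
Qed.

(** If the term of index 0 of a thread [code (lpt w g)] lies in a compact
    neighbourhood [K], then [g] moves a point of the compact image of [L] into
    [K], so that only the elements of a finite set [F] occur. The image of [A]
    is therefore locally a finite union of compact sets. *)
Lemma code_closed (A : set (limG S)) : closed A -> closed (code @` A).
Proof.
move=> clA z zA.
have [K cK zK] := compact_nbhs X_locally_compact (thread z 0).
have cC := compactU (word_limit_range_compact LP) cK.
pose F := [set g |
  [set gs_act X x g | x in range L `|` K] `&` (range L `|` K) !=set0].
pose B := \bigcup_(g in F) (code_thread^~ g @` [set w | A (lpt w g)]).
have clB : closed B.
  apply: closed_bigcup => [|g _]; first exact: X_proper cC.
  apply: compact_closed.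
    by apply: projlim_hausdorff; exact: stage_hausdorff.
  apply: continuous_compact.
    by apply: continuous_subspaceT; exact: code_thread_continuous.
  apply: subclosed_compact (@lseq_compact G S) _ => //.
  by move/continuous_closedP: (@lpt_continuous G S g); apply.
suff [g _ [w Aw <-]] : B z by exists (lpt w g) => //; exact: codeE.
apply: clB => U zU.
have /zA[_ [[y Ay <-] [Uy Ky]]] :
    nbhs z (U `&` [set t : projlim (step I) | K (thread t 0)]).
  by apply: filterI zU _; exact: (@thread_continuous _ _ (step I) 0 z _ zK).
exists (code y); split=> //; move: Ay Ky {Uy}.
elim/limG_ind: y => w g Ay; rewrite codeE => Ky.
exists g; last by exists w.
exists (igs_act X (L (wshift 0 w)) g); split; last by right.
by exists (L (wshift 0 w)) => //; left; exists (wshift 0 w).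
Qed.

(** The points [u N], obtained by replacing in a representative
    [xi (x) x_N ... x_1 . g] of the [N]-th term the point [xi] by the value of
    [L], converge to the given thread, and the image of [code] is closed. *)
Lemma code_surj z : exists y, code y = z.
Proof.
(* A thread has a term in [X (x) M], so the set of letters is inhabited. *)
have [y _] : exists y : letter S, True.
  by elim/gtens_ind: (thread z 1) => _ m; exists (bhead (m : S)).
have [C [cC CP]] := X_cocompact.
have /choice[p pP] N : exists p : Y * (lseq S * G),
    C p.1 /\ thread z N = stage_pt N p.1 p.2.1 p.2.2.
  have [xi [w [g e]]] := stage_pt_surj y (thread z N).
  have [_ [[k _ <-] Ck]] := CP xi.
  have [u [h e']] := stage_pt_translate N xi w g k.
  by exists (gs_act X xi k, (u, h)); rewrite e.
have : closure (range code) z; last first.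
  by move=> /(code_closed closedT)[y' _ <-]; exists y'.
pose u N := code_thread (p N).2.1 (p N).2.2.
suff uz : u @ \oo --> z.
  move=> U /uz[N _ NU]; exists (u N); split; last exact: NU (leqnn N).
  by exists (lpt (p N).2.1 (p N).2.2) => //; exact: codeE.
apply: cvg_thread => n A; rewrite {1}(pP n).2 => nA.
have /nbhs_mdist[e e0 eA] :=
  @stage_pt_continuous G S X n (p n).2.1 (p n).2.2 (p n).1 _ nA.
have [k0 k0P] := LP cC e0.
exists (n + k0)%N => // N /= nN.
rewrite -(subnKC (leq_trans (leq_addr _ _) nN)).
set j := (N - n)%N; have k0j : (k0 <= j)%N.
  by rewrite leq_subRL ?(leq_trans (leq_addr _ _) nN).
have [Cxi /thread_stage_pt] := pP (n + j)%N; rewrite /u.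
move: (p (n + j)%N).1 (p (n + j)%N).2.1 (p (n + j)%N).2.2 Cxi => xi w g Cxi.
(* The isometry [k] transports the estimate to the fixed representative [p n],
   in which closeness in [X (x) M^n] can be tested. *)
rewrite (pP n).2 => /stage_pt_eq[k [e1 e2 e3]].
have -> : thread (code_thread w g) n =
    stage_pt n (gs_act X (L (wshift n w)) k) (p n).2.1 (p n).2.2.
  by apply/esym; apply: (@stage_pt_eq G S X _ _ _ _ _ _ _).2; exists k.
by apply: eA; rewrite e1 igs_isom metric_sym; exact: k0P.
Qed.

End Coding.

Theorem theorem5p9 (R : realType) (G : groupType) (S : selfSimilar G)
    (S_contracting : contracting_group S)
    (X : isomGSpace R G)
    (X_nonempty : [set: X] !=set0)
    (X_locally_compact : locally_compact [set: X])
    (X_cocompact : cocompact_action X)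
    (X_proper : proper_action X)
    (I : gmap (gtens X S) X)
    (I_contracting : contracting_map I) :
  exists Phi : gmap (projlim (step I)) (limG S),
    homeomorphism Phi /\
    forall x : S,
      exists x_agree : agree (step I) (rtens_stage x),
        forall xi : projlim (step I),
          Phi (lim_map x_agree xi) = limG_tens (Phi xi) x.
Proof.
have [m [lambda [lambda01 act_contract]]] := contracting_map_wact I_contracting.
have [L LP] := word_limit X_locally_compact X_cocompact lambda01 act_contract
  X_nonempty.
pose psi : limG S -> projlim (step I) := code LP.
have psi_inj : injective psi by exact: code_inj.
have psi_act z g :
    psi (gs_act (limG S) z g) = gs_act (projlim (step I)) (psi z) g.
  exact: code_equivariant.
have psi_tens z x :
    psi (limG_tens z x) = lim_map (rtens_stage_agree I x) (psi z).
  exact: code_tens.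
have /choice[phi phiK] : forall z, exists y, psi y = z.
  by move=> z; exact: code_surj.
have psiK : cancel psi phi by move=> y; apply: psi_inj; rewrite phiK.
have phi_continuous : continuous phi.
  apply/continuous_closedP => A clA.
  have -> : phi @^-1` A = psi @` A.
    apply/seteqP; split=> [z Az|_ [y Ay <-]]; first by exists (phi z).
    by rewrite /= psiK.
  exact: code_closed.
have phi_equivariant z g : phi (gs_act (projlim (step I)) z g) =
    gs_act (limG S) (phi z) g.
  by apply: psi_inj; rewrite psi_act !phiK.
exists (GMap phi_continuous phi_equivariant); split.
  split=> //; exists psi; split=> //; exact: code_continuous.
move=> x; exists (rtens_stage_agree I x) => z.
by apply: psi_inj; rewrite psi_tens !phiK.
Qed.
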